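(* Let $A$ be a ring. Given a morphism $g:(P_1,e_1)\to(P_0,e_0)$ of Seifert $A$-modules, let $C$ be the $1$-dimensional f.g. projective $A$-module chain complex $$d_C=g:C_1=P_1\to C_0=P_0$$ and let $e:C\to C$ be the $A$-module chain map with components $e_0:C_0\to C_0$ and $e_1:C_1\to C_1$. The following conditions on $g$ are equivalent: (i) $B(g):B(P_1,e_1)\to B(P_0,e_0)$ is an isomorphism of Blanchfield $A[z,z^{-1}]$-modules. (ii) There exists a morphism $h:(P_0,e_0)\to(P_1,e_1)$ of Seifert $A$-modules such that $$gh=(e_0(1-e_0))^k:P_0\to P_0,\qquad hg=(e_1(1-e_1))^k:P_1\to P_1$$ for some $k\geq0$, defining a chain homotopy $h:(e(1-e))^k\simeq0:C\to C$. (iii) There exist $1$-dimensional f.g. projective $A$-module chain complexes $C^+,C^-$ with chain maps $$e^+:C^+\to C^+,\qquad e^-:C^-\to C^-$$ such that $1-e^+:C^+\to C^+$ and $e^-:C^-\to C^-$ are chain homotopy nilpotent, and with a chain equivalence $$i=\begin{pmatrix}i^+\\ i^-\end{pmatrix}:C\to C^+\oplus C^-$$ such that $$e^+i^+=i^+e:C\to C^+,\qquad e^-i^-=i^-e:C\to C^-.$$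
   Context: $A$ is an associative ring with $1$; ''f.g.'' means finitely generated. A Seifert $A$-module $(P,e)$ is a f.g. projective $A$-module $P$ with an endomorphism $e$; a morphism $g:(P,e)\to(P',e')$ is an $A$-module morphism $g:P\to P'$ with $e'g=ge$. The covering of $(P,e)$ is $B(P,e)=\mathrm{coker}(1-e+ze:P[z,z^{-1}]\to P[z,z^{-1}])$, with $P[z,z^{-1}]=A[z,z^{-1}]\otimes_AP$. It is a Blanchfield $A[z,z^{-1}]$-module, meaning that $1-z$ acts on it as an automorphism and it has a $1$-dimensional resolution by modules $Q[z,z^{-1}]$ with $Q$ a f.g. projective $A$-module. $B(g):B(P,e)\to B(P',e')$ is the morphism induced by $g$ on cokernels. A $1$-dimensional f.g. projective chain complex is a complex of f.g. projective modules concentrated in degrees $0$ and $1$. A self chain map $f$ is chain homotopy nilpotent if $f^k\simeq0$ for some $k\geq0$. *)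

(* Defs.v *)
From HB Require Import structures.
From mathcomp Require Import all_boot all_order all_algebra.
From mathcomp Require Import boolp finmap.
From mathcomp Require Import monalg zify.

Set Implicit Arguments.
Unset Strict Implicit.
Unset Printing Implicit Defensive.

Import GRing.Theory.
Local Open Scope ring_scope.

Definition is_iso (R : pzRingType) (M N : lmodType R) (f : {linear M -> N}) :
  Prop := exists f' : {linear N -> M}, cancel f f' /\ cancel f' f.

Section FinitelyGeneratedProjective.
Variable A : pzRingType.

Definition finitely_generated (P : lmodType A) : Prop :=
  exists (n : nat) (s : 'I_n -> P),
    forall x : P, exists a : 'I_n -> A, x = \sum_(i < n) a i *: s i.

Definition projective (P : lmodType A) : Prop :=
  forall (M N : lmodType A) (p : {linear M -> N}) (f : {linear P -> N}),
    (forall y : N, exists x : M, p x = y) ->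
    exists f' : {linear P -> M}, forall x : P, p (f' x) = f x.

Record fgProj := FgProj {
  fgp_sort :> lmodType A;
  fgp_fg : finitely_generated fgp_sort;
  fgp_proj : projective fgp_sort }.
Arguments fgp_proj _ : clear implicits.

Section Prod.
Variables P Q : lmodType A.

Lemma finitely_generated_prod :
  finitely_generated P -> finitely_generated Q ->
  finitely_generated (P * Q)%type.
Proof.
move=> [n [s sP]] [m [t tQ]].
exists (n + m)%N, (fun i => match split i with
  | inl j => (s j, 0) | inr j => (0, t j) end) => -[x y].
have [a ->] := sP x; have [b ->] := tQ y.
exists (fun i => match split i with inl j => a j | inr j => b j end).
have spl (i : 'I_n) : split (lshift m i) = inl i := unsplitK (inl i).
have spr (i : 'I_m) : split (rshift n i) = inr i := unsplitK (inr i).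
rewrite big_split_ord /=.
under [X in _ = X + _]eq_bigr => i _ do rewrite !spl.
under [X in _ = _ + X]eq_bigr => i _ do rewrite !spr.
apply: injective_projections; rewrite raddfD !raddf_sum /=.
  by rewrite [X in _ + X]big1 ?addr0 // => i _; rewrite scaler0.
by rewrite [X in X + _]big1 ?add0r // => i _; rewrite scaler0.
Qed.

Lemma projective_prod (pP : projective P) (pQ : projective Q) :
  projective (P * Q)%type.
Proof.
move=> M N p f p_surj.
pose inlP (x : P) : P * Q := (x, 0).
pose inrQ (y : Q) : P * Q := (0, y).
have lin_l : linear inlP by move=> a u v; apply: injective_projections; rewrite /= ?scaler0 ?addr0.
have lin_r : linear inrQ by move=> a u v; apply: injective_projections; rewrite /= ?scaler0 ?addr0.
pose Il := GRing.isLinear.Build _ _ _ _ inlP lin_l.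
pose Ir := GRing.isLinear.Build _ _ _ _ inrQ lin_r.
pose il : {linear P -> (P * Q)%type} := HB.pack inlP Il.
pose ir : {linear Q -> (P * Q)%type} := HB.pack inrQ Ir.
have [fl flE] := pP M N p (f \o il) p_surj.
have [fr frE] := pQ M N p (f \o ir) p_surj.
exists ((fl \o fst) \+ (fr \o snd)) => -[x y] /=.
by rewrite linearD flE frE /= -linearD /=; congr (f (_, _));
  rewrite ?addr0 ?add0r.
Qed.

End Prod.
Arguments projective_prod [P Q] pP pQ.

Definition fgp_prod (P Q : fgProj) : fgProj :=
  FgProj (finitely_generated_prod (fgp_fg P) (fgp_fg Q))
         (projective_prod (fgp_proj P) (fgp_proj Q)).

End FinitelyGeneratedProjective.

Section Cokernel.
Variables (R : pzRingType) (M N : lmodType R) (f : {linear M -> N}).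

Definition im_pred : {pred N} := fun y => `[< exists x, f x = y >].

Lemma im_predP y : reflect (exists x, f x = y) (y \in im_pred).
Proof. exact: asboolP. Qed.

Fact im_pred_zmod_closed : zmod_closed im_pred.
Proof.
split=> [|_ _ /im_predP[x <-] /im_predP[y <-]]; apply/im_predP.
  by exists 0; rewrite linear0.
by exists (x - y); rewrite linearB.
Qed.
HB.instance Definition _ :=
  GRing.isZmodClosed.Build N im_pred im_pred_zmod_closed.

Definition coker := Quotient.quot im_pred.
HB.instance Definition _ := GRing.Zmodule.on coker.

Definition coker_proj_fun (x : N) : coker := (\pi_(Quotient.quot im_pred) x)%qT.

Lemma coker_proj_eq x y :
  coker_proj_fun x = coker_proj_fun y <-> exists u, f u = x - y.
Proof.
split=> [/eqP|fxy]; first by rewrite -Quotient.idealrBE => /im_predP.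
by apply/eqP; rewrite -Quotient.idealrBE; apply/im_predP.
Qed.

Lemma coker_proj_surj (y : coker) : exists x, coker_proj_fun x = y.
Proof. by exists (repr y); rewrite /coker_proj_fun reprK. Qed.

Lemma coker_projD : {morph coker_proj_fun : x y / x + y}.
Proof. by move=> x y; rewrite /coker_proj_fun Quotient.pi_add. Qed.

Definition coker_scale (a : R) (x : coker) : coker :=
  coker_proj_fun (a *: repr (x : Quotient.quot im_pred)).

Lemma coker_scaleE a x :
  coker_scale a (coker_proj_fun x) = coker_proj_fun (a *: x).
Proof.
apply/coker_proj_eq; rewrite -scalerBr.
have /coker_proj_eq[u uE] : coker_proj_fun
    (repr (coker_proj_fun x : Quotient.quot im_pred)) = coker_proj_fun x.
  by rewrite /coker_proj_fun reprK.
by exists (a *: u); rewrite linearZ /= uE.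
Qed.

Fact coker_scaleA a b x :
  coker_scale a (coker_scale b x) = coker_scale (a * b) x.
Proof.
by have [y <-] := coker_proj_surj x; rewrite !coker_scaleE scalerA.
Qed.
Fact coker_scale1 : left_id 1 coker_scale.
Proof.
by move=> x; have [y <-] := coker_proj_surj x; rewrite !coker_scaleE scale1r.
Qed.
Fact coker_scaleDr : right_distributive coker_scale +%R.
Proof.
move=> a x x'; have [y <-] := coker_proj_surj x.
have [y' <-] := coker_proj_surj x'.
by rewrite -coker_projD !coker_scaleE scalerDr coker_projD.
Qed.
Fact coker_scaleDl x : {morph coker_scale^~ x : a b / a + b}.
Proof.
move=> a b; have [y <-] := coker_proj_surj x.
by rewrite !coker_scaleE scalerDl coker_projD.
Qed.
HB.instance Definition _ := GRing.Zmodule_isLmodule.Build R coker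
  coker_scaleA coker_scale1 coker_scaleDr coker_scaleDl.

Fact coker_proj_linear : linear coker_proj_fun.
Proof. by move=> a x y; rewrite coker_projD -coker_scaleE. Qed.
HB.instance Definition _ :=
  GRing.isLinear.Build R N coker *:%R coker_proj_fun coker_proj_linear.
Definition coker_proj : {linear N -> coker} := coker_proj_fun.

End Cokernel.

Section CokernelMap.
Variables (R : pzRingType) (M N M' N' : lmodType R).
Variables (f : {linear M -> N}) (f' : {linear M' -> N'}).
Variables (u : {linear M -> M'}) (v : {linear N -> N'}).
Hypothesis sq : forall x, f' (u x) = v (f x).

Definition coker_map_fun (_ : forall x, f' (u x) = v (f x)) (x : coker f) :
  coker f' := coker_proj f' (v (repr (x : Quotient.quot (im_pred f)))).

Lemma coker_map_projE x :
  coker_map_fun sq (coker_proj f x) = coker_proj f' (v x).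
Proof.
apply/coker_proj_eq; rewrite -linearB.
have /coker_proj_eq[w wE] : coker_proj f
    (repr (coker_proj f x : Quotient.quot (im_pred f))) = coker_proj f x.
  by rewrite /coker_proj /= /coker_proj_fun reprK.
by exists (u w); rewrite sq wE.
Qed.

Fact coker_map_linear : linear (coker_map_fun sq).
Proof.
move=> a x y; have [x' <-] := coker_proj_surj x.
have [y' <-] := coker_proj_surj y.
rewrite -[coker_proj_fun f x']/(coker_proj f x') -[coker_proj_fun f y']/(coker_proj f y').
by rewrite -linearP !coker_map_projE !linearP.
Qed.
HB.instance Definition _ := GRing.isLinear.Build R (coker f) (coker f') *:%R
  (coker_map_fun sq) coker_map_linear.
Definition coker_map : {linear coker f -> coker f'} := coker_map_fun sq.

End CokernelMap.

(* Convolution of finitely supported families indexed by int, along a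
   biadditive operation on the coefficients. *)
Section Convolution.
Variables (G H L : zmodType) (op : G -> H -> L).

Definition conv (a : {malg G[int]}) (x : {malg H[int]}) : {malg L[int]} :=
  \sum_(i <- msupp a) \sum_(j <- msupp x) << op a@_i x@_j *g i + j >>.

Hypothesis opDl : forall a b x, op (a + b) x = op a x + op b x.
Hypothesis opDr : forall a x y, op a (x + y) = op a x + op a y.

Let op0l x : op 0 x = 0.
Proof. by apply: (addrI (op 0 x)); rewrite -opDl !addr0. Qed.
Let op0r a : op a 0 = 0.
Proof. by apply: (addrI (op a 0)); rewrite -opDr !addr0. Qed.

Lemma convEw a x (d e : {fset int}) :
  (msupp a `<=` d)%fset -> (msupp x `<=` e)%fset ->
  conv a x = \sum_(i <- d) \sum_(j <- e) << op a@_i x@_j *g i + j >>.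
Proof.
move=> sad sxe; rewrite /conv (big_fset_incl _ sad) /=; last first.
  move=> i _ /mcoeff_outdom ->; rewrite big1 // => j _.
  by rewrite op0l monalgU0.
apply: eq_bigr => i _; apply: big_fset_incl => // j _ /mcoeff_outdom ->.
by rewrite op0r monalgU0.
Qed.

Lemma convDl a b x : conv (a + b) x = conv a x + conv b x.
Proof.
have sxx := fsubset_refl (msupp x).
rewrite (convEw (msuppD_le a b) sxx).
rewrite (convEw (fsubsetUl (msupp a) (msupp b)) sxx).
rewrite (convEw (fsubsetUr (msupp a) (msupp b)) sxx).
rewrite -big_split; apply: eq_bigr => i _; rewrite -big_split.
by apply: eq_bigr => j _; rewrite mcoeffD opDl monalgUD.
Qed.

Lemma convDr a x y : conv a (x + y) = conv a x + conv a y.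
Proof.
have saa := fsubset_refl (msupp a).
rewrite (convEw saa (msuppD_le x y)).
rewrite (convEw saa (fsubsetUl (msupp x) (msupp y))).
rewrite (convEw saa (fsubsetUr (msupp x) (msupp y))).
rewrite -big_split; apply: eq_bigr => i _; rewrite -big_split.
by apply: eq_bigr => j _; rewrite mcoeffD opDr monalgUD.
Qed.

Lemma convU a x i j :
  conv << a *g i >> << x *g j >> = << op a x *g i + j >>.
Proof.
by rewrite (convEw msuppU_le msuppU_le) !big_seq_fset1 !mcoeffUU.
Qed.

End Convolution.

Lemma malg_ind_add (G : zmodType) (Pr : {malg G[int]} -> Prop) :
  (forall c i, Pr << c *g i >>) -> (forall x y, Pr x -> Pr y -> Pr (x + y)) ->
  forall x, Pr x.
Proof.
move=> PU PD x; rewrite [x]monalgE; elim/big_ind: _ => //.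
by rewrite -(monalgU0 (G := G) 0).
Qed.

(* The Laurent polynomial ring A[z,z^-1]: the formal sum << a *g n >> stands
   for a z^n, with z central. *)
Section LaurentRing.
Variable A : pzRingType.

Definition laurent := {malg A[int]}.
HB.instance Definition _ := GRing.Zmodule.on laurent.

Implicit Types a b c : laurent.

Definition laurent_one : laurent := << 1 *g 0 >>.
Definition laurent_mul : laurent -> laurent -> laurent := conv *%R.

Let mDl := convDl (@mulrDl A) (@mulrDr A).
Let mDr := convDr (@mulrDl A) (@mulrDr A).
Let mU := convU (@mulrDl A) (@mulrDr A).

Fact laurent_mulDl : left_distributive laurent_mul +%R.
Proof. exact: mDl. Qed.
Fact laurent_mulDr : right_distributive laurent_mul +%R.
Proof. exact: mDr. Qed.
Fact laurent_mulA : associative laurent_mul.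
Proof.
move=> a b c; rewrite /laurent_mul; elim/malg_ind_add: a => [a i|a a' ea ea'];
  last by rewrite !mDl ea ea'.
elim/malg_ind_add: b => [b j|b b' eb eb']; last by rewrite mDl !mDr mDl eb eb'.
elim/malg_ind_add: c => [c k|c c' ec ec']; last by rewrite !mDr ec ec'.
by rewrite !mU mulrA addrA.
Qed.
Fact laurent_mul1 : left_id laurent_one laurent_mul.
Proof.
move=> a; rewrite /laurent_mul; elim/malg_ind_add: a => [a i|a a' ea ea'];
  last by rewrite mDr ea ea'.
by rewrite mU mul1r add0r.
Qed.
Fact laurent_mulr1 : right_id laurent_one laurent_mul.
Proof.
move=> a; rewrite /laurent_mul; elim/malg_ind_add: a => [a i|a a' ea ea'];
  last by rewrite mDl ea ea'.
by rewrite mU mulr1 addr0.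
Qed.
HB.instance Definition _ := GRing.Zmodule_isPzRing.Build laurent
  laurent_mulA laurent_mul1 laurent_mulr1 laurent_mulDl laurent_mulDr.

Definition laurentC (a : A) : laurent := << a *g 0 >>.
Definition laurentZ : laurent := << 1 *g 1 >>.

End LaurentRing.

(* P[z,z^-1], as the formal sums of x z^n with x in P. It is A[z,z^-1] (x)_A P
   with a (x) x = laurent_tensor a x, see laurent_tensor_universal. *)
Section LaurentModule.
Variables (A : pzRingType) (P : lmodType A).

Definition laurent_mod := {malg P[int]}.
HB.instance Definition _ := GRing.Zmodule.on laurent_mod.

Definition laurent_scale : laurent A -> laurent_mod -> laurent_mod :=
  conv *:%R.

Let opDl (a b : A) (x : P) : (a + b) *: x = a *: x + b *: x.
Proof. exact: scalerDl. Qed.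
Let opDr (a : A) (x y : P) : a *: (x + y) = a *: x + a *: y.
Proof. exact: scalerDr. Qed.
Let sDl := convDl opDl opDr.
Let sDr := convDr opDl opDr.
Let sU := convU opDl opDr.

Fact laurent_scaleA a b x :
  laurent_scale a (laurent_scale b x) = laurent_scale (a * b) x.
Proof.
have mDl := convDl (@mulrDl A) (@mulrDr A).
have mDr := convDr (@mulrDl A) (@mulrDr A).
rewrite /laurent_scale -[a * b]/(conv *%R a b).
elim/malg_ind_add: a => [a i|a a' ea ea']; last by rewrite mDl !sDl ea ea'.
elim/malg_ind_add: b => [b j|b b' eb eb']; last by rewrite mDr !sDl sDr eb eb'.
elim/malg_ind_add: x => [x k|x x' ex ex']; last by rewrite !sDr ex ex'.
by rewrite (convU (@mulrDl A) (@mulrDr A)) !sU scalerA addrA.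
Qed.
Fact laurent_scale1 : left_id 1 laurent_scale.
Proof.
move=> x; rewrite /laurent_scale.
elim/malg_ind_add: x => [x k|x x' ex ex']; last by rewrite !sDr ex ex'.
by rewrite -[1]/(<< 1 *g 0 >>) sU scale1r add0r.
Qed.
Fact laurent_scaleDr : right_distributive laurent_scale +%R.
Proof. exact: sDr. Qed.
Fact laurent_scaleDl x : {morph laurent_scale^~ x : a b / a + b}.
Proof. by move=> a b; apply: sDl. Qed.
HB.instance Definition _ :=
  GRing.Zmodule_isLmodule.Build (laurent A) laurent_mod
    laurent_scaleA laurent_scale1 laurent_scaleDr laurent_scaleDl.

Lemma laurent_scaleU (a : A) (x : P) (i j : int) :
  (<< a *g i >> : laurent A) *: (<< x *g j >> : laurent_mod)
  = << a *: x *g i + j >>.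
Proof. exact: sU. Qed.

Definition laurent_tensor (a : laurent A) (x : P) : laurent_mod :=
  a *: (<< x *g 0 >> : laurent_mod).

Lemma laurent_tensor_balanced a (c : A) x :
  laurent_tensor (a * laurentC c) x = laurent_tensor a (c *: x).
Proof.
by rewrite /laurent_tensor -scalerA laurent_scaleU addr0.
Qed.

Lemma laurent_tensorDl a b x :
  laurent_tensor (a + b) x = laurent_tensor a x + laurent_tensor b x.
Proof. exact: scalerDl. Qed.

Lemma laurent_tensorDr a x y :
  laurent_tensor a (x + y) = laurent_tensor a x + laurent_tensor a y.
Proof. by rewrite /laurent_tensor monalgUD scalerDr. Qed.

Lemma laurent_tensorZ a b x :
  a *: laurent_tensor b x = laurent_tensor (a * b) x.
Proof. exact: scalerA. Qed.

Lemma laurent_tensor_universal (G : zmodType) (phi : laurent A -> P -> G) :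
  (forall a b x, phi (a + b) x = phi a x + phi b x) ->
  (forall a x y, phi a (x + y) = phi a x + phi a y) ->
  (forall a c x, phi (a * laurentC c) x = phi a (c *: x)) ->
  exists psi : {additive laurent_mod -> G},
    (forall a x, psi (laurent_tensor a x) = phi a x) /\
    (forall psi' : {additive laurent_mod -> G},
      (forall a x, psi' (laurent_tensor a x) = phi a x) -> psi' =1 psi).
Proof.
move=> phiDl phiDr phiB.
have phi0 a : phi a 0 = 0.
  by apply: (addrI (phi a 0)); rewrite -phiDr !addr0.
pose psi (x : laurent_mod) : G :=
  \sum_(n <- msupp x) phi << 1 *g n >> x@_n.
have psiE (x : laurent_mod) (d : {fset int}) : (msupp x `<=` d)%fset ->
    psi x = \sum_(n <- d) phi << 1 *g n >> x@_n.
  move=> sxd; apply: big_fset_incl => // n _ /mcoeff_outdom ->.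
  exact: phi0.
have psiD x y : psi (x + y) = psi x + psi y.
  rewrite (psiE _ _ (msuppD_le x y)).
  rewrite (psiE _ _ (fsubsetUl (msupp x) (msupp y))).
  rewrite (psiE _ _ (fsubsetUr (msupp x) (msupp y))).
  by rewrite -big_split; apply: eq_bigr => n _; rewrite mcoeffD phiDr.
have psi0 : psi 0 = 0 by apply: (addrI (psi 0)); rewrite -psiD !addr0.
have psiB : zmod_morphism psi.
  by move=> x y; apply: (addIr (psi y)); rewrite -psiD !addrNK.
pose Psi := GRing.isZmodMorphism.Build _ _ psi psiB.
exists (HB.pack psi Psi : {additive laurent_mod -> G}); split=> [a x|psi' e] /=.
  elim/malg_ind_add: a => [a i|a a' ea ea']; last first.
    by rewrite laurent_tensorDl psiD ea ea' phiDl.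
  rewrite /laurent_tensor laurent_scaleU addr0 (psiE _ _ msuppU_le).
  rewrite big_seq_fset1 mcoeffUU -phiB -[X in phi X]/(conv *%R _ _).
  by rewrite (convU (@mulrDl A) (@mulrDr A)) mul1r addr0.
move=> x; elim/malg_ind_add: x => [x i|x x' ex ex']; last first.
  by rewrite raddfD psiD ex ex'.
rewrite (psiE _ _ msuppU_le) big_seq_fset1 mcoeffUU -e; congr (psi' _).
by rewrite /laurent_tensor laurent_scaleU scale1r addr0.
Qed.

End LaurentModule.

Section LaurentMap.
Variables (A : pzRingType) (P Q : lmodType A) (f : {linear P -> Q}).

Definition laurent_map_fun (x : laurent_mod P) : laurent_mod Q :=
  \sum_(n <- msupp x) << f x@_n *g n >>.

Let mapEw (x : laurent_mod P) (d : {fset int}) : (msupp x `<=` d)%fset ->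
  laurent_map_fun x = \sum_(n <- d) << f x@_n *g n >>.
Proof.
move=> sxd; apply: big_fset_incl => // n _ /mcoeff_outdom ->.
by rewrite linear0 monalgU0.
Qed.

Lemma laurent_mapU x n : laurent_map_fun << x *g n >> = << f x *g n >>.
Proof. by rewrite (mapEw msuppU_le) big_seq_fset1 mcoeffUU. Qed.

Lemma mcoeff_laurent_map x n : (laurent_map_fun x)@_n = f x@_n.
Proof.
rewrite {2}[x]monalgE /laurent_map_fun !raddf_sum /=; apply: eq_bigr => i _.
by rewrite !mcoeffU raddfMn.
Qed.

Let mapD x y :
  laurent_map_fun (x + y) = laurent_map_fun x + laurent_map_fun y.
Proof.
by apply/malgP => n; rewrite mcoeffD !mcoeff_laurent_map mcoeffD linearD.
Qed.

Fact laurent_map_linear : linear laurent_map_fun.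
Proof.
move=> a x y; rewrite mapD; congr (_ + _).
elim/malg_ind_add: a => [a i|a a' ea ea']; last first.
  by rewrite !scalerDl mapD ea ea'.
elim/malg_ind_add: x => [x j|x x' ex ex']; last first.
  by rewrite mapD !scalerDr mapD ex ex'.
by rewrite laurent_mapU !laurent_scaleU laurent_mapU linearZ.
Qed.
HB.instance Definition _ := GRing.isLinear.Build (laurent A)
  (laurent_mod P) (laurent_mod Q) *:%R laurent_map_fun laurent_map_linear.

Definition laurent_map : {linear laurent_mod P -> laurent_mod Q} :=
  laurent_map_fun.

End LaurentMap.

Lemma mcoeff_laurentZ (A : pzRingType) (P : lmodType A) (x : laurent_mod P)
  (n : int) : (laurentZ A *: x)@_n = x@_(n - 1).
Proof.
elim/malg_ind_add: x => [x j|x y ex ey]; last first.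
  by rewrite scalerDr !mcoeffD ex ey.
rewrite laurent_scaleU scale1r !mcoeffU; congr (_ *+ nat_of_bool _).
by apply/eqP/eqP; lia.
Qed.

Lemma laurentZ_scaleA (A : pzRingType) (P : lmodType A) (a : laurent A)
  (x : laurent_mod P) : laurentZ A *: (a *: x) = a *: (laurentZ A *: x).
Proof.
elim/malg_ind_add: a => [a i|a a' ea ea']; last by rewrite !scalerDl !scalerDr ea ea'.
elim/malg_ind_add: x => [x j|x x' ex ex']; last by rewrite !scalerDr ex ex'.
by rewrite !laurent_scaleU !scale1r addrCA.
Qed.

Record blanchfield (A : pzRingType) := Blanchfield {
  bl_mod :> lmodType (laurent A);
  bl_auto : bijective (fun x : bl_mod => (1 - laurentZ A) *: x);
  bl_res : exists (Q1 Q0 : fgProj A)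
      (d : {linear laurent_mod Q1 -> laurent_mod Q0})
      (p : {linear laurent_mod Q0 -> bl_mod}),
    [/\ injective d,
        forall x, p x = 0 <-> exists y, d y = x
      & forall y, exists x, p x = y] }.

Section Seifert.
Variable A : pzRingType.

Record seifert := Seifert {
  sf_mod :> fgProj A;
  sf_endo : {linear sf_mod -> sf_mod} }.

Record seifert_mor (P P' : seifert) := SeifertMor {
  sm_fun :> {linear P -> P'};
  sm_comm : forall x, sf_endo P' (sm_fun x) = sm_fun (sf_endo P x) }.

End Seifert.

Section Covering.
Variable A : pzRingType.
Notation z := (laurentZ A).

Section Object.
Variable P : seifert A.
Notation e := (laurent_map (sf_endo P)).

Definition covering_res_fun (x : laurent_mod P) : laurent_mod P :=
  x - e x + z *: e x.

Fact covering_res_linear : linear covering_res_fun.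
Proof.
move=> a x y; rewrite /covering_res_fun linearP [z *: _]scalerDr.
rewrite laurentZ_scaleA [in RHS]scalerDr scalerBr opprD.
by rewrite (addrACA (a *: x)) (addrACA (a *: x - _)).
Qed.
HB.instance Definition _ := GRing.isLinear.Build (laurent A)
  (laurent_mod P) (laurent_mod P) *:%R covering_res_fun covering_res_linear.
Definition covering_res : {linear laurent_mod P -> laurent_mod P} :=
  covering_res_fun.

Lemma covering_res_inj : injective covering_res.
Proof.
apply: raddf_inj => x res0; set E := sf_endo P; pose F y := y - E y.
have FE y : F (E y) = E (F y) by rewrite /F linearB.
have FN y : F (- y) = - F y by rewrite /F linearN opprB opprK addrC.
have F0 : F 0 = 0 by rewrite /F linear0 subrr.
have rel n : F x@_n = - E x@_(n - 1).
  have /(congr1 (mcoeff n)) := res0.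
  rewrite /covering_res /= /covering_res_fun !mcoeffD mcoeffN mcoeff_laurentZ.
  by rewrite !mcoeff_laurent_map mcoeff0 => /eqP; rewrite addr_eq0 => /eqP.
have [N xN] : exists N : nat, forall n : int, (N <= `|n|)%N -> x@_n = 0.
  elim/malg_ind_add: x {res0 rel} => [x i|x y [Nx ex] [Ny ey]].
    exists `|i|.+1%N => n Nn; rewrite mcoeffU; case: eqP => // ein.
    by rewrite ein ltnn in Nn.
  exists (maxn Nx Ny) => n; rewrite geq_max => /andP[Nxn Nyn].
  by rewrite mcoeffD ex ?ey ?addr0.
have iterFE m y : iter m F (E y) = E (iter m F y).
  by elim: m => //= m ->; rewrite FE.
have iterEF m y : iter m E (F y) = F (iter m E y).
  by elim: m => //= m ->; rewrite FE.
have iterFN m y : iter m F (- y) = - iter m F y.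
  by elim: m => //= m ->; rewrite FN.
have iterEN m y : iter m E (- y) = - iter m E y.
  by elim: m => //= m ->; rewrite linearN.
have nilF m : iter m F x@_(m%:Z - N%:Z) = 0.
  elim: m => [|m IHm]; first by rewrite /= sub0r xN ?abszN.
  rewrite iterSr rel iterFN iterFE intS.
  rewrite (_ : _ - 1 = m%:Z - N%:Z) ?IHm ?linear0 ?oppr0 //.
  by rewrite addrAC [1 + _]addrC addrK.
have nilE m : iter m E x@_(N%:Z - m%:Z) = 0.
  elim: m => [|m IHm]; first by rewrite /= subr0 xN.
  rewrite iterSr -[E _]opprK.
  rewrite (_ : N%:Z - m.+1%:Z = N%:Z - m%:Z - 1); last first.
    by rewrite intS opprD addrA addrAC.
  by rewrite -rel iterEN iterEF IHm F0 oppr0.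
have both k l y : iter k F y = 0 -> iter l E y = 0 -> y = 0.
  move: {2}(k + l)%N (leqnn (k + l)) => s; elim: s k l y => [|s IHs] k l y.
    by rewrite leqn0 addn_eq0 => /andP[/eqP-> _].
  case: k => [|k]; first by move=> _ /= ->.
  case: l => [|l]; first by move=> _ _ /= ->.
  rewrite addSn addnS ltnS => kls.
  rewrite !iterSr => Fy Ey.
  have F1 : F y = 0.
    by apply: (IHs k l.+1); rewrite ?addnS // iterSr -FE iterEF Ey F0.
  have E1 : E y = 0.
    apply: (IHs k.+1 l); rewrite ?addSn // iterSr FE iterFE.
    by rewrite Fy linear0.
  by move: F1; rewrite /F E1 subr0.
apply/malgP => n; rewrite mcoeff0.
have [/xN //|nN] := leqP N `|n|.
apply: (both `|(n + N%:Z)%R|%N `|(N%:Z - n)%R|%N).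
  have {2}-> : n = `|(n + N%:Z)%R|%N%:Z - N%:Z by lia.
  exact: nilF.
have {2}-> : n = N%:Z - `|(N%:Z - n)%R|%N%:Z by lia.
exact: nilE.
Qed.

Let laurent_endo_sq x : covering_res (e x) = e (covering_res x).
Proof.
by rewrite /covering_res /= /covering_res_fun linearD linearB linearZ.
Qed.

Let coker_endoK x : coker_proj covering_res ((1 - z) *: e x)
  = coker_proj covering_res x.
Proof.
apply/coker_proj_eq; exists (- x).
by rewrite linearN /= /covering_res_fun scalerBl scale1r opprD opprB addrAC.
Qed.

Lemma covering_auto :
  bijective (fun x : coker covering_res => (1 - z) *: x).
Proof.
exists (coker_map laurent_endo_sq) => x.
  have [y <-] := coker_proj_surj x.
  rewrite -[coker_proj_fun _ y]/(coker_proj _ y) -linearZ.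
  by rewrite [LHS]coker_map_projE linearZ coker_endoK.
have [y <-] := coker_proj_surj x.
rewrite -[coker_proj_fun _ y]/(coker_proj _ y).
by rewrite [coker_map _ _]coker_map_projE -linearZ coker_endoK.
Qed.

Definition covering : blanchfield A.
Proof.
refine (@Blanchfield A (coker covering_res) covering_auto _).
exists P, P, covering_res, (coker_proj covering_res); split.
- exact: covering_res_inj.
- move=> x; rewrite -{1}(linear0 (coker_proj covering_res)).
  by rewrite -[x in exists y, _ = x]subr0; apply: coker_proj_eq.
- exact: coker_proj_surj.
Defined.

End Object.

Section Morphism.
Variables (P P' : seifert A) (g : seifert_mor P P').

Lemma covering_sq (x : laurent_mod P) :
  covering_res P' (laurent_map g x) = laurent_map g (covering_res P x).
Proof.
have ge y : laurent_map (sf_endo P') (laurent_map g y)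
    = laurent_map g (laurent_map (sf_endo P) y).
  by apply/malgP => n; rewrite !mcoeff_laurent_map sm_comm.
by rewrite /covering_res /= /covering_res_fun linearD linearB linearZ /= -!ge.
Qed.

Definition covering_map : {linear covering P -> covering P'} :=
  coker_map covering_sq.

End Morphism.
End Covering.

(* 1-dimensional f.g. projective chain complexes, concentrated in degrees
   0 and 1. *)
Section ChainComplex.
Variable A : pzRingType.

Record complex1 := Complex1 {
  ch1 : fgProj A;
  ch0 : fgProj A;
  chd : {linear ch1 -> ch0} }.

Record chain_map (C D : complex1) := ChainMap {
  cm1 : {linear ch1 C -> ch1 D};
  cm0 : {linear ch0 C -> ch0 D};
  cm_comm : forall x, chd D (cm1 x) = cm0 (chd C x) }.

Definition cm_eq C D (f f' : chain_map C D) : Prop :=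
  cm1 f =1 cm1 f' /\ cm0 f =1 cm0 f'.

(* d h + h d = f - f', where h lives in the single degree 0 -> 1. *)
Definition chain_homotopy C D (h : {linear ch0 C -> ch1 D})
    (f f' : chain_map C D) : Prop :=
  (forall x, chd D (h x) = cm0 f x - cm0 f' x) /\
  (forall x, h (chd C x) = cm1 f x - cm1 f' x).

Definition chain_homotopic C D (f f' : chain_map C D) : Prop :=
  exists h : {linear ch0 C -> ch1 D}, chain_homotopy h f f'.

Definition cm_id C : chain_map C C :=
  @ChainMap C C idfun idfun (fun _ => erefl).

Fact cm_zero_comm C D x : chd D (\0 x : ch1 D) = \0 (chd C x).
Proof. exact: linear0. Qed.
Definition cm_zero C D : chain_map C D :=
  @ChainMap C D \0 \0 (@cm_zero_comm C D).

Fact cm_comp_comm C D E (f : chain_map D E) (g : chain_map C D) x :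
  chd E ((cm1 f \o cm1 g) x) = (cm0 f \o cm0 g) (chd C x).
Proof. by rewrite /= !cm_comm. Qed.
Definition cm_comp C D E (f : chain_map D E) (g : chain_map C D) :
  chain_map C E := ChainMap (cm_comp_comm f g).

Fact cm_sub_comm C D (f g : chain_map C D) x :
  chd D ((cm1 f \- cm1 g) x) = (cm0 f \- cm0 g) (chd C x).
Proof. by rewrite /= linearB !cm_comm. Qed.
Definition cm_sub C D (f g : chain_map C D) : chain_map C D :=
  ChainMap (cm_sub_comm f g).

Fixpoint cm_exp C (f : chain_map C C) (k : nat) : chain_map C C :=
  if k is k'.+1 then cm_comp f (cm_exp f k') else cm_id C.

Definition chain_homotopy_nilpotent C (f : chain_map C C) : Prop :=
  exists k : nat, chain_homotopic (cm_exp f k) (cm_zero C C).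

Definition chain_equivalence C D (f : chain_map C D) : Prop :=
  exists f' : chain_map D C,
    chain_homotopic (cm_comp f' f) (cm_id C) /\
    chain_homotopic (cm_comp f f') (cm_id D).

Section DirectSum.
Variables C D : complex1.

Definition ch_sum_d_fun (x : ch1 C * ch1 D) : ch0 C * ch0 D :=
  (chd C x.1, chd D x.2).
Fact ch_sum_d_linear : linear ch_sum_d_fun.
Proof.
by move=> a x y; apply: injective_projections; rewrite /= linearP.
Qed.
HB.instance Definition _ := GRing.isLinear.Build A (ch1 C * ch1 D)%type
  (ch0 C * ch0 D)%type *:%R ch_sum_d_fun ch_sum_d_linear.

Definition ch_sum : complex1 :=
  @Complex1 (fgp_prod (ch1 C) (ch1 D)) (fgp_prod (ch0 C) (ch0 D)) ch_sum_d_fun.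
End DirectSum.

Section PairFun.
Variables (P Q Q' : lmodType A) (f : {linear P -> Q}) (f' : {linear P -> Q'}).

Definition pair_fun (x : P) : Q * Q' := (f x, f' x).
Fact pair_fun_linear : linear pair_fun.
Proof.
by move=> a x y; apply: injective_projections; rewrite /= linearP.
Qed.
HB.instance Definition _ := GRing.isLinear.Build A P
  (Q * Q')%type *:%R pair_fun pair_fun_linear.
End PairFun.

Section Pairing.
Variables (C D D' : complex1) (f : chain_map C D) (f' : chain_map C D').

Fact cm_pair_comm x : chd (ch_sum D D') (pair_fun (cm1 f) (cm1 f') x)
  = pair_fun (cm0 f) (cm0 f') (chd C x).
Proof. by rewrite /= /ch_sum_d_fun /pair_fun /= !cm_comm. Qed.

Definition cm_pair : chain_map C (ch_sum D D') :=
  @ChainMap C (ch_sum D D') (pair_fun (cm1 f) (cm1 f'))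
    (pair_fun (cm0 f) (cm0 f')) cm_pair_comm.

End Pairing.

Section SeifertComplex.
Variables (P1 P0 : seifert A) (g : seifert_mor P1 P0).

Definition seifert_complex : complex1 := @Complex1 P1 P0 g.

Definition seifert_chain_endo : chain_map seifert_complex seifert_complex :=
  @ChainMap seifert_complex seifert_complex (sf_endo P1) (sf_endo P0)
    (fun x => esym (sm_comm g x)).

End SeifertComplex.

Definition cm_e1e C (e : chain_map C C) : chain_map C C :=
  cm_comp e (cm_sub (cm_id C) e).

End ChainComplex.

Definition sf_e1e (A : pzRingType) (P : seifert A) (x : P) : P :=
  sf_endo P (x - sf_endo P x).
Arguments sf_e1e {A} P x.

(* Main.v *)
From HB Require Import structures.
From mathcomp Require Import all_boot all_order all_algebra.
From mathcomp Require Import boolp finmap monalg ring zify.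
Require Import Defs.

Set Implicit Arguments.
Unset Strict Implicit.
Unset Printing Implicit Defensive.

Import GRing.Theory.
Local Open Scope ring_scope.

(** Let [s] denote the endomorphism [e]. A Seifert module is a module over the
    polynomials in [s] that is f.g. projective over [A], and in its covering the
    relation [1 - s + z s = 0] makes [s] inverse to [1 - z] and [1 - s] equal
    to [- z s]. The covering is therefore the localization that inverts
    [s (1 - s)]: this element acts bijectively on it ([covering_act_bij]), the
    kernel of [x |-> [x z^0]] consists of the elements killed by a power of
    [s (1 - s)] ([covering_in_ker]), and multiplication by a high power brings
    an element of bounded support back into [P] ([clear_denominators]).

    If [h] inverts [g] up to a power of [s (1 - s)], both composites of the
    coverings of [g] and [h] are bijective, hence so is the covering of [g].
    Conversely, lift the inverse of the covering of [g] on [P0] to Laurent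
    polynomials over [P1], by projectivity, and clear denominators. The map
    [P0 -> P1] so obtained satisfies the equations required of [h] in the
    localization, hence exactly after multiplication by a further power, since
    [P0] and [P1] are finitely generated.

    A pair [g], [h] with both composites [s^k (1 - s)^k] factors, as [s^k] and
    [(1 - s)^k] are comaximal, through a third Seifert module [Q], the image of
    an explicit idempotent of [P1 + P0] ([seifert_factorization]). The two
    factors [Q -> P0] and [P1 -> Q] of [g] are the complexes [C^+] and [C^-],
    and the maps from [C] to them commute with [e] on the nose. Conversely, a
    splitting gives [(e (1 - e))^n] null-homotopic for large [n], by some
    homotopy [h'] that need not commute with [e]; the composite of [h'] with
    [(e (1 - e))^n] does. *)

(** * Integer polynomials acting through an endomorphism *)

Section PolyAction.
Variables (R : pzRingType) (M : lmodType R) (e : {linear M -> M}).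
Implicit Types (p q : {poly int}) (x y : M).

(** The action of [p] in Z['X] on [M], with 'X acting as the endomorphism [e].
    Integer coefficients are central, so [p] acts linearly even though [R] need
    not be commutative. *)
Definition poly_act p x : M := \sum_(i < size p) iter i e x *~ p`_i.

Fact poly_act_linear p : linear (poly_act p).
Proof.
have iterP i a x y : iter i e (a *: x + y) = a *: iter i e x + iter i e y.
  by elim: i => //= i ->; rewrite linearP.
move=> a x y; rewrite /poly_act scaler_sumr -big_split; apply: eq_bigr => i _ /=.
by rewrite iterP mulrzDl -scalerMzr.
Qed.
HB.instance Definition _ p :=
  GRing.isLinear.Build R M M *:%R (poly_act p) (poly_act_linear p).

Lemma poly_actEw n p x : (size p <= n)%N ->
  poly_act p x = \sum_(i < n) iter i e x *~ p`_i.
Proof.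
move=> pn; rewrite /poly_act (big_ord_widen n (fun i => iter i e x *~ p`_i) pn).
rewrite big_mkcond; apply: eq_bigr => i _.
by case: ltnP => // /(nth_default 0) ->; rewrite mulr0z.
Qed.

Lemma poly_actDl p q x : poly_act (p + q) x = poly_act p x + poly_act q x.
Proof.
rewrite (poly_actEw x (leq_maxl (size p) (size q))).
rewrite (poly_actEw x (leq_maxr (size p) (size q))).
rewrite (poly_actEw x (size_polyD p q)) -big_split; apply: eq_bigr => i _ /=.
by rewrite coefD mulrzDr.
Qed.

Lemma poly_actCM c p x : poly_act (c%:P * p) x = poly_act p x *~ c.
Proof.
have cp : (size (c%:P * p)%R <= size p)%N by rewrite mul_polyC size_scale_leq.
rewrite (poly_actEw x cp) /poly_act mulrz_suml; apply: eq_bigr => i _.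
by rewrite coefCM mulrC mulrzA.
Qed.

Lemma poly_act1 x : poly_act 1 x = x.
Proof. by rewrite /poly_act size_poly1 big_ord1 coef1 mulr1z. Qed.

Lemma poly_actXM p x : poly_act (p * 'X) x = e (poly_act p x).
Proof.
have pX : (size (p * 'X)%R <= (size p).+1)%N.
  by apply: leq_trans (size_polyMleq _ _) _; rewrite size_polyX addn2.
rewrite (poly_actEw x pX) big_ord_recl coefMX mulr0z add0r /poly_act raddf_sum.
by apply: eq_bigr => i _; rewrite coefMX raddfMz.
Qed.

Lemma poly_actA p q x : poly_act p (poly_act q x) = poly_act (p * q) x.
Proof.
elim/poly_ind: p => [|p c IHp].
  by rewrite mul0r /poly_act size_poly0 !big_ord0.
rewrite poly_actDl mulrDl poly_actDl poly_actXM poly_actCM IHp.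
rewrite -poly_actXM mulrAC; congr (_ + _).
by rewrite -[c%:P]mulr1 poly_actCM poly_act1.
Qed.

Lemma poly_actX x : poly_act 'X x = e x.
Proof. by rewrite -['X]mul1r poly_actXM poly_act1. Qed.

Lemma poly_actN p x : poly_act (- p) x = - poly_act p x.
Proof. by rewrite -mulN1r -polyCN poly_actCM mulrNz mulr1z. Qed.

Lemma poly_actBl p q x : poly_act (p - q) x = poly_act p x - poly_act q x.
Proof. by rewrite poly_actDl poly_actN. Qed.

Lemma poly_act_exp p k x : poly_act (p ^+ k) x = iter k (poly_act p) x.
Proof. by elim: k => [|k IHk]; rewrite ?poly_act1 // exprS -poly_actA IHk. Qed.

Lemma poly_actC p q x : poly_act p (poly_act q x) = poly_act q (poly_act p x).
Proof. by rewrite !poly_actA mulrC. Qed.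

Lemma poly_act_comm p x : e (poly_act p x) = poly_act p (e x).
Proof. by rewrite -poly_actXM -poly_actA poly_actX. Qed.

End PolyAction.

(** Additivity of [f] suffices, so that the two modules may live over different
    rings. *)
Lemma poly_act_nat (R R' : pzRingType) (M : lmodType R) (M' : lmodType R')
    (e : {linear M -> M}) (e' : {linear M' -> M'}) (f : {additive M -> M'}) :
  (forall x, e' (f x) = f (e x)) ->
  forall p x, f (poly_act e p x) = poly_act e' p (f x).
Proof.
move=> fe p x; rewrite /poly_act raddf_sum; apply: eq_bigr => i _.
rewrite raddfMz; congr (_ *~ _).
by elim: (i : nat) => //= n <-; rewrite fe.
Qed.

(** The ideals ('X^k) and ((1 - 'X)^l) of Z['X] are comaximal. *)
Lemma bezout_X_1subX k l :
  exists a b : {poly int}, a * 'X ^+ k + b * (1 - 'X) ^+ l = 1.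
Proof.
elim: k l => [|k IHk] l; first by exists 1, 0; rewrite expr0 mul0r addr0 mulr1.
elim: l => [|l [a [b ab]]]; first by exists 0, 1; rewrite expr0 mul0r add0r mulr1.
have [a' [b' ab']] := IHk l.+1.
exists (a' + (1 - 'X) * a), ('X * b' + b).
(* [1 = 'X + (1 - 'X)], the first summand multiplied by the relation for
   [(k, l + 1)] and the second by the relation for [(k + 1, l)]. *)
transitivity ('X * (a' * 'X ^+ k + b' * (1 - 'X) ^+ l.+1)
    + (1 - 'X) * (a * 'X ^+ k.+1 + b * (1 - 'X) ^+ l)).
  by rewrite !exprS; ring.
by rewrite ab ab'; ring.
Qed.

(** * Maps on cokernels and splitting of idempotents *)

Lemma coker_lift (R : pzRingType) (M N L : lmodType R) (f : {linear M -> N})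
    (v : {linear N -> L}) : (forall x, v (f x) = 0) ->
  exists w : {linear coker f -> L}, forall x, w (coker_proj f x) = v x.
Proof.
move=> vf; pose w (y : coker f) : L := v (repr (y : Quotient.quot (im_pred f))).
have wE x : w (coker_proj f x) = v x.
  have /coker_proj_eq[u uE] : coker_proj f
      (repr (coker_proj f x : Quotient.quot (im_pred f))) = coker_proj f x.
    by rewrite /coker_proj /= /coker_proj_fun reprK.
  by apply/eqP; rewrite -subr_eq0 -linearB -uE vf.
have w_lin : linear w.
  move=> a x y; have [x' <-] := coker_proj_surj x.
  have [y' <-] := coker_proj_surj y.
  rewrite -[coker_proj_fun f x']/(coker_proj f x').
  rewrite -[coker_proj_fun f y']/(coker_proj f y').
  by rewrite -linearP !wE linearP.
pose W := GRing.isLinear.Build _ _ _ _ w w_lin.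
by exists (HB.pack w W : {linear coker f -> L}).
Qed.

Lemma split_idempotent (A : pzRingType) (P : fgProj A) (p : {linear P -> P}) :
  (forall x, p (p x) = p x) ->
  exists (Q : fgProj A) (r : {linear P -> Q}) (j : {linear Q -> P}),
    cancel j r /\ forall x, j (r x) = p x.
Proof.
move=> pp; pose q : {linear P -> P} := idfun \- p.
have [|j jE] := @coker_lift _ _ _ _ q p.
  by move=> x; rewrite linearB /= pp subrr.
pose r := coker_proj q.
have jK : cancel j r.
  move=> y; have [x <-] := coker_proj_surj y.
  rewrite -[coker_proj_fun q x]/(coker_proj q x) jE; apply/coker_proj_eq.
  by exists (- x); rewrite linearN /= opprB.
have Qfg : finitely_generated (coker q).
  have [n [s sP]] := fgp_fg P; exists n, (r \o s) => y.
  have [a aE] := sP (j y); exists a.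
  rewrite -[LHS]jK aE linear_sum; apply: eq_bigr => i _; exact: linearZ.
have Qproj : projective (coker q).
  move=> M N f h f_surj; have [h' h'E] := fgp_proj (h \o r) f_surj.
  by exists (h' \o j) => y; rewrite /= h'E /= jK.
by exists (FgProj Qfg Qproj), r, j.
Qed.

(** * Seifert modules *)

(** The polynomial by which [e (1 - e)] acts. *)
Notation E1E := ('X * (1 - 'X) : {poly int}).

Section SeifertAction.
Variable A : pzRingType.

Lemma iter_sf_e1e (P : seifert A) k x :
  iter k (sf_e1e P) x = poly_act (sf_endo P) (E1E ^+ k) x.
Proof.
rewrite poly_act_exp; apply: eq_iter => y.
by rewrite -poly_actA poly_actX poly_actBl poly_act1 poly_actX.
Qed.

Lemma seifert_mor_act (P P' : seifert A) (g : seifert_mor P P') p x :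
  g (poly_act (sf_endo P) p x) = poly_act (sf_endo P') p (g x).
Proof. exact: poly_act_nat (sm_comm g) p x. Qed.

End SeifertAction.

(** Writing [u = e^k], [v = (1 - e)^k], a pair [g], [h] with both composites
    equal to [u v] factors as [g = gp gm], [h = hm hp] through a Seifert module
    [Q], in such a way that [gm], [hm] compose to [u] and [gp], [hp] compose to
    [v]. With [a u + b v = 1], the module [Q] is the image of the idempotent of
    [P1 + P0] with matrix [[a u, a h], [b g, b v]]. *)
Lemma seifert_factorization (A : pzRingType) (P1 P0 : seifert A)
    (g : seifert_mor P1 P0) (h : seifert_mor P0 P1) (k : nat) :
  (forall x, g (h x) = poly_act (sf_endo P0) (E1E ^+ k) x) ->
  (forall x, h (g x) = poly_act (sf_endo P1) (E1E ^+ k) x) ->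
  exists (Q : seifert A) (gm : seifert_mor P1 Q) (gp : seifert_mor Q P0)
    (hp : seifert_mor P0 Q) (hm : seifert_mor Q P1),
    [/\ (forall x, gp (gm x) = g x),
        (forall x, hm (hp x) = h x),
        (forall x, hm (gm x) = poly_act (sf_endo P1) ('X ^+ k) x)
          /\ (forall x, gm (hm x) = poly_act (sf_endo Q) ('X ^+ k) x)
      & (forall x, gp (hp x) = poly_act (sf_endo P0) ((1 - 'X) ^+ k) x)
          /\ (forall x, hp (gp x) = poly_act (sf_endo Q) ((1 - 'X) ^+ k) x)].
Proof.
have [a [b]] := bezout_X_1subX k k; rewrite exprMn.
set u := 'X ^+ k; set v := (1 - 'X) ^+ k => ab gh hg.
pose e1 := sf_endo P1; pose e0 := sf_endo P0; pose PP := fgp_prod P1 P0.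
have gE p x : g (poly_act e1 p x) = poly_act e0 p (g x) := seifert_mor_act g p x.
have hE p x : h (poly_act e0 p x) = poly_act e1 p (h x) := seifert_mor_act h p x.
pose gam : {linear PP -> P0} := (g \o fst) \+ (poly_act e0 v \o snd).
pose eta : {linear PP -> P1} := (poly_act e1 u \o fst) \+ (h \o snd).
pose pi : {linear PP -> PP} :=
  pair_fun (poly_act e1 a \o eta) (poly_act e0 b \o gam).
pose ee : {linear PP -> PP} := pair_fun (e1 \o fst) (e0 \o snd).
pose il : {linear P1 -> PP} := pair_fun idfun \0.
pose ir : {linear P0 -> PP} := pair_fun \0 idfun.
have PP_eq (w w' : PP) : w.1 = w'.1 -> w.2 = w'.2 -> w = w'.
  exact: injective_projections.
have gampi w : gam (pi w) = gam w.
  rewrite /gam /pi /= /pair_fun /= gE /eta /= !linearD /= gE gh !poly_actA.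
  rewrite addrACA -!poly_actDl (_ : _ + _ = 1); last by rewrite -ab; ring.
  rewrite poly_act1 (_ : _ + _ = v) //.
  by rewrite -[RHS]mul1r -ab; ring.
have etapi w : eta (pi w) = eta w.
  rewrite /eta /pi /= /pair_fun /= hE /gam /= !linearD /= hE hg !poly_actA.
  rewrite addrACA -!poly_actDl (_ : u * a + b * v = 1); last by rewrite -ab; ring.
  rewrite poly_act1 (_ : _ + _ = u) //.
  by rewrite -[RHS]mul1r -ab; ring.
have pi1 w : (pi w).1 = poly_act e1 a (eta w) by [].
have pi2 w : (pi w).2 = poly_act e0 b (gam w) by [].
have pipi w : pi (pi w) = pi w.
  by apply: PP_eq; rewrite !(pi1, pi2) ?etapi ?gampi.
have fst_ee p w : (poly_act ee p w).1 = poly_act e1 p w.1.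
  exact: (@poly_act_nat _ _ _ _ ee e1 fst).
have snd_ee p w : (poly_act ee p w).2 = poly_act e0 p w.2.
  exact: (@poly_act_nat _ _ _ _ ee e0 snd).
have eta_ee w : e1 (eta w) = eta (ee w).
  by rewrite /eta /= linearD /= poly_act_comm (sm_comm h).
have gam_ee w : e0 (gam w) = gam (ee w).
  by rewrite /gam /= linearD /= poly_act_comm (sm_comm g).
have pi_ee w : ee (pi w) = pi (ee w).
  apply: PP_eq.
    by rewrite pi1 -eta_ee -poly_act_comm.
  by rewrite pi2 -gam_ee -poly_act_comm.
have [Q0 [r [j [jK jr]]]] := split_idempotent pipi.
pose eQ : {linear Q0 -> Q0} := r \o ee \o j; pose Q := Seifert eQ.
have j_inj : injective j := can_inj jK.
have pij q : pi (j q) = j q by rewrite -jr jK.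
have j_ee q : ee (j q) = j (eQ q) by rewrite /= jr -pi_ee pij.
have r_ee w : eQ (r w) = r (ee w).
  by apply: j_inj; rewrite /= jr !jr -pi_ee pipi.
have jE p q : j (poly_act eQ p q) = poly_act ee p (j q).
  exact: (@poly_act_nat _ _ _ _ eQ ee j).
have il_ee x : ee (il x) = il (e1 x).
  by apply: PP_eq; rewrite //= linear0.
have ir_ee x : ee (ir x) = ir (e0 x).
  by apply: PP_eq; rewrite //= linear0.
have gm_comm x : sf_endo Q (r (il x)) = r (il (sf_endo P1 x)).
  by rewrite [LHS]r_ee il_ee.
have hp_comm x : sf_endo Q (r (ir x)) = r (ir (sf_endo P0 x)).
  by rewrite [LHS]r_ee ir_ee.
have gp_comm q : sf_endo P0 (gam (j q)) = gam (j (sf_endo Q q)).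
  by rewrite [LHS]gam_ee j_ee.
have hm_comm q : sf_endo P1 (eta (j q)) = eta (j (sf_endo Q q)).
  by rewrite [LHS]eta_ee j_ee.
pose gm : seifert_mor P1 Q := @SeifertMor A P1 Q (r \o il) gm_comm.
pose hp : seifert_mor P0 Q := @SeifertMor A P0 Q (r \o ir) hp_comm.
pose gp : seifert_mor Q P0 := @SeifertMor A Q P0 (gam \o j) gp_comm.
pose hm : seifert_mor Q P1 := @SeifertMor A Q P1 (eta \o j) hm_comm.
have gmE x : gm x = r (il x) by [].
have hpE x : hp x = r (ir x) by [].
have gpE q : gp q = gam (j q) by [].
have hmE q : hm q = eta (j q) by [].
have gam_il x : gam (il x) = g x by rewrite /gam /= linear0 addr0.
have gam_ir x : gam (ir x) = poly_act e0 v x by rewrite /gam /= linear0 add0r.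
have eta_il x : eta (il x) = poly_act e1 u x by rewrite /eta /= linear0 addr0.
have eta_ir x : eta (ir x) = h x by rewrite /eta /= linear0 add0r.
have g_eta w : g (eta w) = poly_act e0 u (gam w).
  by rewrite /eta /gam /= !linearD /= gE gh poly_actA.
have h_gam w : h (gam w) = poly_act e1 v (eta w).
  by rewrite /eta /gam /= !linearD /= hE hg poly_actA mulrC.
exists Q, gm, gp, hp, hm; split=> [x|x||].
- by rewrite gpE gmE jr gampi gam_il.
- by rewrite hmE hpE jr etapi eta_ir.
- split=> [x|q]; first by rewrite hmE gmE jr etapi eta_il.
  apply: j_inj; rewrite jE gmE hmE jr; apply: PP_eq.
    by rewrite fst_ee pi1 eta_il poly_actC -pi1 pij.
  by rewrite snd_ee pi2 gam_il g_eta poly_actC -pi2 pij.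
- split=> [x|q]; first by rewrite gpE hpE jr gampi gam_ir.
  apply: j_inj; rewrite jE hpE gpE jr; apply: PP_eq.
    by rewrite fst_ee pi1 eta_ir h_gam poly_actC -pi1 pij.
  by rewrite snd_ee pi2 gam_ir poly_actC -pi2 pij.
Qed.

(** * Chain homotopy nilpotence *)

Section Nilpotence.
Variable A : pzRingType.

Lemma cm0_exp (C : complex1 A) (f : chain_map C C) k x :
  cm0 (cm_exp f k) x = iter k (cm0 f) x.
Proof. by elim: k => //= k ->. Qed.

Lemma cm1_exp (C : complex1 A) (f : chain_map C C) k x :
  cm1 (cm_exp f k) x = iter k (cm1 f) x.
Proof. by elim: k => //= k ->. Qed.

Lemma chain_homotopy_exp0 (C : complex1 A) (f : chain_map C C) k
    (h : {linear ch0 C -> ch1 C}) :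
  chain_homotopy h (cm_exp f k) (cm_zero C C) <->
  (forall x, chd C (h x) = iter k (cm0 f) x) /\
  (forall x, h (chd C x) = iter k (cm1 f) x).
Proof.
by split=> -[h0 h1]; split=> x; rewrite ?h0 ?h1 ?cm0_exp ?cm1_exp subr0.
Qed.

Lemma poly_act_1subX_exp (M : lmodType A) (e : {linear M -> M}) k x :
  iter k (fun y => y - e y) x = poly_act e ((1 - 'X) ^+ k) x.
Proof.
rewrite poly_act_exp; apply: eq_iter => y.
by rewrite poly_actBl poly_act1 poly_actX.
Qed.

Lemma poly_actX_exp (M : lmodType A) (e : {linear M -> M}) k x :
  iter k e x = poly_act e ('X ^+ k) x.
Proof. by rewrite poly_act_exp; apply: eq_iter => y; rewrite poly_actX. Qed.

End Nilpotence.

Section NilpotentSplitting.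
Variables (A : pzRingType) (P1 P0 : seifert A) (g : seifert_mor P1 P0).
Let C := seifert_complex g.
Let e : chain_map C C := seifert_chain_endo g.

(** With the notation of [seifert_factorization], [C^+] is the complex [gp] and
    [C^-] is the complex [gm]. The map [C -> C^+] is [gm] in degree 1 and the
    identity in degree 0; the map [C -> C^-] is [(1 - e)^k] in degree 1 and
    [hp] in degree 0. *)
Lemma splitting_of_nilpotent (h : seifert_mor P0 P1) (k : nat) :
  (forall x, g (h x) = poly_act (sf_endo P0) (E1E ^+ k) x) ->
  (forall x, h (g x) = poly_act (sf_endo P1) (E1E ^+ k) x) ->
  exists (Cp Cm : complex1 A)
         (ep : chain_map Cp Cp) (em : chain_map Cm Cm)
         (ip : chain_map C Cp) (im : chain_map C Cm),
    chain_homotopy_nilpotent (cm_sub (cm_id Cp) ep) /\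
    chain_homotopy_nilpotent em /\
    chain_equivalence (cm_pair ip im) /\
    cm_eq (cm_comp ep ip) (cm_comp ip e) /\
    cm_eq (cm_comp em im) (cm_comp im e).
Proof.
move=> gh hg.
have [Q [gm [gp [hp [hm [gpm hmp [hgm ghm] [ghp hgp]]]]]]] :=
  seifert_factorization gh hg.
have [a [b ab]] := bezout_X_1subX k k.
set u := 'X ^+ k in hgm ghm ab; set v := (1 - 'X) ^+ k in ghp hgp ab.
pose act (P : seifert A) p : {linear P -> P} := poly_act (sf_endo P) p.
pose Cp := seifert_complex gp; pose Cm := seifert_complex gm.
pose ep : chain_map Cp Cp := seifert_chain_endo gp.
pose em : chain_map Cm Cm := seifert_chain_endo gm.
pose ip : chain_map C Cp := @ChainMap A C Cp gm idfun gpm.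
have im_comm x : chd Cm (act P1 v x) = hp (chd C x).
  by rewrite /= seifert_mor_act -hgp gpm.
pose im : chain_map C Cm := @ChainMap A C Cm (act P1 v) hp im_comm.
pose D := ch_sum Cp Cm.
(* The homotopy inverse is [(a hm, b)] in degree 1 and [(a e^k, b gp)] in
   degree 0; it is a strict left inverse. *)
pose r1 : {linear ch1 D -> P1} :=
  (act P1 a \o hm \o fst) \+ (act P1 b \o snd).
pose r0 : {linear ch0 D -> P0} :=
  (act P0 (a * u) \o fst) \+ (act P0 b \o gp \o snd).
have r_comm w : chd C (r1 w) = r0 (chd D w).
  rewrite /r1 /r0 /= /ch_sum_d_fun /= linearD /= !seifert_mor_act -poly_actA.
  by rewrite -[in LHS]gpm ghm seifert_mor_act gpm.
pose r : chain_map D C := @ChainMap A D C r1 r0 r_comm.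
(* The homotopy from [i r] to the identity has matrix
   [[- b hp, b], [a h, - a hm]]. *)
pose H : {linear ch0 D -> ch1 D} :=
  pair_fun ((act Q b \o snd) \- (act Q b \o hp \o fst))
           ((act P1 a \o h \o fst) \- (act P1 a \o hm \o snd)).
have bv : b * v = 1 - a * u by rewrite -ab addrC addKr.
have D1 (w w' : ch1 D) : w.1 = w'.1 -> w.2 = w'.2 -> w = w'.
  exact: injective_projections.
have D0 (w w' : ch0 D) : w.1 = w'.1 -> w.2 = w'.2 -> w = w'.
  exact: injective_projections.
exists Cp, Cm, ep, em, ip, im; split; [|split; [|split; [|split]]].
- exists k, hp; apply/chain_homotopy_exp0; split=> x.
    by rewrite [LHS]ghp -poly_act_1subX_exp.
  by rewrite [LHS]hgp -poly_act_1subX_exp.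
- exists k, hm; apply/chain_homotopy_exp0; split=> x.
    by rewrite [LHS]ghm -poly_actX_exp.
  by rewrite [LHS]hgm -poly_actX_exp.
- exists r; split.
    exists \0; split=> x.
      rewrite /= /pair_fun /r0 /= linear0 ghp poly_actA -poly_actDl ab.
      by rewrite poly_act1 subrr.
    rewrite /= /pair_fun /r1 /= hgm !poly_actA -poly_actDl ab.
    by rewrite poly_act1 subrr.
  exists H; split=> w.
    apply: D0.
      rewrite /= /r0 /= linearB /= !seifert_mor_act ghp poly_actA bv.
      by rewrite poly_actBl poly_act1 opprB addrCA addrA.
    rewrite /= /r0 /= linearB /= !seifert_mor_act ghm poly_actA.
    rewrite linearD /= !seifert_mor_act hgp poly_actA bv poly_actBl poly_act1.
    rewrite addrA [in RHS]addrAC addrK; congr (_ - _).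
    by rewrite -poly_actA -ghm hmp.
  apply: D1.
    rewrite /= /r1 /= linearD /= !seifert_mor_act ghm hgp !poly_actA bv.
    by rewrite poly_actBl poly_act1 opprB addrCA addrA.
  rewrite /= /r1 /= -[h (gp _)]hmp hgp seifert_mor_act hgm linearD /= !poly_actA.
  rewrite [v * a]mulrC [v * b]mulrC bv poly_actBl poly_act1 addrA.
  by rewrite [RHS]addrAC addrK.
- by split=> x //=; rewrite ?sm_comm.
- by split=> x /=; rewrite ?sm_comm ?poly_act_comm.
Qed.

(** Since [1 - ep] and [em] are homotopy nilpotent, [(e (1 - e))^n] is
    null-homotopic on both summands for large [n], hence on [C]. *)
Lemma nilpotent_of_splitting (Cp Cm : complex1 A)
    (ep : chain_map Cp Cp) (em : chain_map Cm Cm)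
    (ip : chain_map C Cp) (im : chain_map C Cm) :
  chain_homotopy_nilpotent (cm_sub (cm_id Cp) ep) ->
  chain_homotopy_nilpotent em ->
  chain_equivalence (cm_pair ip im) ->
  cm_eq (cm_comp ep ip) (cm_comp ip e) ->
  cm_eq (cm_comp em im) (cm_comp im e) ->
  exists (h : seifert_mor P0 P1) (k : nat),
    (forall x, g (h x) = poly_act (sf_endo P0) (E1E ^+ k) x) /\
    (forall x, h (g x) = poly_act (sf_endo P1) (E1E ^+ k) x).
Proof.
move=> [k [Kp /chain_homotopy_exp0[Kp0 Kp1]]] [l [Km /chain_homotopy_exp0[Km0 Km1]]].
move=> [r [[H [H0 H1]] _]] [epi1 epi0] [emi1 emi0].
have {}Kp0 x : chd Cp (Kp x) = poly_act (cm0 ep) ((1 - 'X) ^+ k) x.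
  by rewrite Kp0 -poly_act_1subX_exp.
have {}Kp1 x : Kp (chd Cp x) = poly_act (cm1 ep) ((1 - 'X) ^+ k) x.
  by rewrite Kp1 -poly_act_1subX_exp.
have {}Km0 x : chd Cm (Km x) = poly_act (cm0 em) ('X ^+ l) x.
  by rewrite Km0 poly_actX_exp.
have {}Km1 x : Km (chd Cm x) = poly_act (cm1 em) ('X ^+ l) x.
  by rewrite Km1 poly_actX_exp.
pose n := (k + l)%N; pose e0 := sf_endo P0; pose e1 := sf_endo P1.
pose wp : {poly int} := 'X ^+ n * (1 - 'X) ^+ l.
pose wm : {poly int} := 'X ^+ k * (1 - 'X) ^+ n.
(* [(e (1 - e))^n] contains the factors [(1 - e)^k] and [e^l] that are
   null-homotopic on the respective summands. *)
have wpE : wp * (1 - 'X) ^+ k = E1E ^+ n.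
  by rewrite /wp /n exprMn [in RHS](exprD (1 - 'X)); ring.
have wmE : wm * 'X ^+ l = E1E ^+ n.
  by rewrite /wm /n exprMn [in RHS](exprD 'X); ring.
pose h' : {linear P0 -> P1} :=
  (cm1 r \o pair_fun (poly_act (cm1 ep) wp \o Kp \o cm0 ip)
                     (poly_act (cm1 em) wm \o Km \o cm0 im))
  \- (H \o poly_act e0 (E1E ^+ n)).
have dact (C' : complex1 A) (f : chain_map C' C') p x :
    chd C' (poly_act (cm1 f) p x) = poly_act (cm0 f) p (chd C' x).
  exact: (poly_act_nat (fun y => esym (cm_comm f y))).
have ip0E p x : cm0 ip (poly_act e0 p x) = poly_act (cm0 ep) p (cm0 ip x).
  exact: (poly_act_nat epi0).
have ip1E p x : cm1 ip (poly_act e1 p x) = poly_act (cm1 ep) p (cm1 ip x).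
  exact: (poly_act_nat epi1).
have im0E p x : cm0 im (poly_act e0 p x) = poly_act (cm0 em) p (cm0 im x).
  exact: (poly_act_nat emi0).
have im1E p x : cm1 im (poly_act e1 p x) = poly_act (cm1 em) p (cm1 im x).
  exact: (poly_act_nat emi1).
have gh' x : g (h' x) = poly_act e0 (E1E ^+ n) x.
  have H0x := H0 (poly_act e0 (E1E ^+ n) x).
  rewrite /h' linearB; apply/eqP; rewrite subr_eq; apply/eqP.
  rewrite [g (_ _ x) in RHS]H0x addrC subrK [LHS](cm_comm r).
  rewrite /= /pair_fun /ch_sum_d_fun /= !dact Kp0 Km0 !poly_actA wpE wmE.
  by rewrite -ip0E -im0E.
have h'g x : h' (g x) = poly_act e1 (E1E ^+ n) x.
  have H1x := H1 (poly_act e1 (E1E ^+ n) x).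
  rewrite /h' /=; apply/eqP; rewrite subr_eq; apply/eqP.
  rewrite -seifert_mor_act [X in _ + X]H1x addrC subrK.
  rewrite /= /pair_fun /=.
  rewrite -(cm_comm ip x) -(cm_comm im x) Kp1 Km1 !poly_actA wpE wmE.
  by rewrite -ip1E -im1E.
(* [h'] commutes with [e] only up to an error annihilated by [g]; composing
   with [(e (1 - e))^n], which is [g h'], removes it. *)
have h_comm x : e1 (h' (poly_act e0 (E1E ^+ n) x))
    = h' (poly_act e0 (E1E ^+ n) (e0 x)).
  rewrite -[poly_act e0 _ x]gh' [h' (g _)]h'g poly_act_comm -h'g -(sm_comm g).
  by rewrite [g _]gh' poly_act_comm.
exists (@SeifertMor A P0 P1 (h' \o poly_act e0 (E1E ^+ n)) h_comm), (n + n)%N.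
split=> x; first by rewrite [LHS]gh' poly_actA -exprD.
rewrite -[LHS]/(h' (poly_act e0 (E1E ^+ n) (g x))).
by rewrite -seifert_mor_act h'g poly_actA -exprD.
Qed.
End NilpotentSplitting.

(** * The covering as a localization *)

Lemma bij_is_iso (R : pzRingType) (M N : lmodType R) (f : {linear M -> N}) :
  injective f -> (forall y, exists x, f x = y) -> is_iso f.
Proof.
move=> f_inj f_surj; have [f' f'K] := choice f_surj.
have f'_lin : linear f' by move=> a x y; apply: f_inj; rewrite linearP !f'K.
pose F := GRing.isLinear.Build _ _ _ _ f' f'_lin.
by exists (HB.pack f' F : {linear N -> M}); split=> // x; apply: f_inj; apply: f'K.
Qed.

Section Covering.
Variable A : pzRingType.
Notation z := (laurentZ A).
Notation zn n := (<< 1 *g n >> : laurent A).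

Lemma laurentZ_unit : zn (-1) * z = 1.
Proof.
rewrite -[LHS]/(conv *%R _ _) (convU (@mulrDl A) (@mulrDr A)) mulr1.
by rewrite addNr.
Qed.

Lemma laurentZ_unit' : z * zn (-1) = 1.
Proof.
rewrite -[LHS]/(conv *%R _ _) (convU (@mulrDl A) (@mulrDr A)) mulr1.
by rewrite addrN.
Qed.

Lemma scale_laurentZ_bij (M : lmodType (laurent A)) :
  bijective (fun y : M => z *: y).
Proof.
exists (fun y : M => zn (-1) *: y) => y /=; rewrite scalerA.
  by rewrite laurentZ_unit scale1r.
by rewrite laurentZ_unit' scale1r.
Qed.

Section Object.
Variable P : seifert A.
Let B := covering P.
Notation e := (sf_endo P).

(** The endomorphism of [P] as a morphism of Seifert modules. *)
Definition seifert_endo_mor : seifert_mor P P :=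
  @SeifertMor A P P e (fun=> erefl).
(** The map of coverings that the endomorphism of [P] induces. *)
Definition covering_endo : {linear covering P -> covering P} :=
  covering_map seifert_endo_mor.
Notation be := covering_endo.

(** The quotient map of the cokernel. *)
Definition covering_proj : {linear laurent_mod P -> covering P} :=
  coker_proj (covering_res P).

Lemma covering_proj_surj (y : B) : exists u, covering_proj u = y.
Proof. exact: coker_proj_surj. Qed.

(** The canonical map from [P] to its covering, [x |-> [x z^0]]; it is the
    localization of the Z['X]-module [P] that inverts ['X (1 - 'X)]. *)
Definition covering_in (x : P) : covering P := covering_proj << x *g 0 >>.

Fact covering_in_zmod : zmod_morphism covering_in.
Proof. by move=> x y; rewrite /covering_in monalgUB linearB. Qed.
HB.instance Definition _ := GRing.isZmodMorphism.Build P
  (covering P : lmodType (laurent A)) covering_in covering_in_zmod.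

Lemma covering_inZ (a : A) x :
  covering_in (a *: x) = laurentC a *: covering_in x.
Proof. by rewrite /covering_in -linearZ /= laurent_scaleU. Qed.

Lemma covering_projU (x : P) n : covering_proj << x *g n >> = zn n *: covering_in x.
Proof. by rewrite /covering_in -linearZ /= laurent_scaleU scale1r addr0. Qed.

Lemma covering_endo_in x : be (covering_in x) = covering_in (e x).
Proof.
rewrite [LHS]coker_map_projE; congr (covering_proj _).
exact: laurent_mapU.
Qed.

Lemma covering_in_act p x :
  covering_in (poly_act e p x) = poly_act be p (covering_in x).
Proof. exact: (poly_act_nat covering_endo_in). Qed.

(** The image of [P] generates the covering over [A[z, z^-1]]. *)
Lemma covering_ext (M : lmodType (laurent A)) (f f' : {linear covering P -> M}) :
  (forall x, f (covering_in x) = f' (covering_in x)) -> f =1 f'.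
Proof.
move=> ff' y; have [u <-] := covering_proj_surj y.
elim/malg_ind_add: u => [x n|u v eu ev].
  by rewrite covering_projU !linearZ /= ff'.
by rewrite [covering_proj _]linearD !linearD /= eu ev.
Qed.

Lemma covering_endoK (y : B) : (1 - z) *: be y = y.
Proof.
have [u <-] := covering_proj_surj y.
rewrite [be _]coker_map_projE -linearZ; apply/coker_proj_eq; exists (- u).
by rewrite linearN /= /covering_res_fun scalerBl scale1r opprD opprB addrAC.
Qed.

Lemma covering_endoK' (y : B) : be ((1 - z) *: y) = y.
Proof. by rewrite linearZ /= covering_endoK. Qed.

Lemma scalez_covering_endo (y : B) : z *: be y = be y - y.
Proof.
have /eqP := covering_endoK y; rewrite scalerBl scale1r subr_eq => /eqP bey.
by rewrite [in RHS]bey addrC addKr.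
Qed.

Lemma covering_endo_bij : bijective be.
Proof.
exists (fun y => (1 - z) *: y) => y; first exact: covering_endoK.
exact: covering_endoK'.
Qed.

(** In the covering, [e (1 - e)] acts as [- z e^2]. *)
Lemma covering_act_bij k : bijective (poly_act be (E1E ^+ k)).
Proof.
have E_bij : bijective (poly_act be E1E).
  apply: (@eq_bij _ _ (fun y => - (z *: be (be y)))).
    apply: (bij_comp (f := -%R)); first exact: (inv_bij opprK).
    apply: (bij_comp (f := fun y : B => z *: y)); first exact: scale_laurentZ_bij.
    exact: bij_comp covering_endo_bij covering_endo_bij.
  move=> y; rewrite scalez_covering_endo opprB -poly_actA poly_actX poly_actBl.
  by rewrite poly_act1 poly_actX linearB.
elim: k => [|k IHk].
  by exists id => y; rewrite poly_act1.
apply: (@eq_bij _ _ _ (bij_comp E_bij IHk)) => y.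
by rewrite /= poly_actA exprS.
Qed.

Lemma covering_in_ker x : covering_in x = 0 ->
  exists k, poly_act e (E1E ^+ k) x = 0.
Proof.
rewrite -[0 in X in X -> _](linear0 covering_proj) => /coker_proj_eq[u].
rewrite subr0 => ux.
have rel n : poly_act e (1 - 'X) u@_n + poly_act e 'X u@_(n - 1) = x *+ (0 == n).
  rewrite -mcoeffU -ux /= /covering_res_fun !mcoeffD mcoeffN mcoeff_laurentZ.
  by rewrite !mcoeff_laurent_map poly_actBl poly_act1 !poly_actX.
have [N uN] : exists N : nat, forall n : int, (N <= `|n|)%N -> u@_n = 0.
  elim/malg_ind_add: (u) => [y i|v w [Nv ev] [Nw ew]].
    exists `|i|.+1%N => n Nn; rewrite mcoeffU; case: eqP => // ein.
    by rewrite ein ltnn in Nn.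
  exists (maxn Nv Nw) => n; rewrite geq_max => /andP[Nvn Nwn].
  by rewrite mcoeffD ev ?ew ?addr0.
(* Below degree 0 the relations give powers of [1 - e] killing [u], starting
   from the bottom of its support; from degree 0 on they give powers of [e],
   starting from the top. *)
have lowE m : (m < N)%N -> poly_act e ((1 - 'X) ^+ m) u@_(m%:Z - N%:Z) = 0.
  elim: m => [|m IHm] mN; first by rewrite poly_act1 uN //; lia.
  have /eqP := rel (m.+1%:Z - N%:Z).
  rewrite (_ : 0 == _ = false); last by lia.
  rewrite (_ : m.+1%:Z - N%:Z - 1 = m%:Z - N%:Z); last by lia.
  rewrite mulr0n addr_eq0 => /eqP relm.
  rewrite exprSr -poly_actA relm linearN /= poly_actC IHm ?linear0 ?oppr0 //.
  exact: ltnW.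
have highE m : (m <= N)%N -> poly_act e ('X ^+ m) u@_(N%:Z - m%:Z) = 0.
  elim: m => [|m IHm] mN; first by rewrite poly_act1 uN //; lia.
  have /eqP := rel (N%:Z - m%:Z).
  rewrite (_ : 0 == _ = false); last by lia.
  rewrite (_ : N%:Z - m%:Z - 1 = N%:Z - m.+1%:Z); last by lia.
  rewrite mulr0n addrC addr_eq0 => /eqP relm.
  by rewrite exprSr -poly_actA relm linearN /= poly_actC IHm ?linear0 ?oppr0 // ltnW.
have low : poly_act e ((1 - 'X) ^+ N) u@_(-1) = 0.
  case: N uN lowE highE => [uN _ _|N uN lowE _].
    by rewrite uN ?linear0.
  rewrite exprS -poly_actA (_ : -1 = N%:Z - N.+1%:Z); last by lia.
  by rewrite lowE ?linear0.
have high : poly_act e ('X ^+ N) u@_0 = 0.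
  by rewrite -[0 in LHS](subrr N%:Z) highE.
exists N; have := rel 0; rewrite eqxx sub0r mulr1n => <-.
have E_low : poly_act e (E1E ^+ N) u@_(-1) = 0.
  by rewrite exprMn -poly_actA low linear0.
have E_high : poly_act e (E1E ^+ N) u@_0 = 0.
  by rewrite exprMn mulrC -poly_actA high linear0.
rewrite linearD /= !(poly_actC e (E1E ^+ N)) E_low E_high.
by rewrite !linear0 addr0.
Qed.

End Object.
End Covering.

(** * Isomorphisms of coverings *)

(** An [A[z, z^-1]]-module regarded as an [A]-module. *)
Section RestrictScalars.
Variables (A : pzRingType) (M : lmodType (laurent A)).

Definition restrict_scalars : Type := M.
HB.instance Definition _ := GRing.Zmodule.on restrict_scalars.

(** Scalars of [A] act as constant Laurent polynomials. *)
Definition restrict_scale (a : A) (x : restrict_scalars) : restrict_scalars :=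
  laurentC a *: (x : M).

Fact restrict_scaleA a b x :
  restrict_scale a (restrict_scale b x) = restrict_scale (a * b) x.
Proof.
rewrite /restrict_scale scalerA -[_ * _ in LHS]/(conv *%R _ _).
by rewrite (convU (@mulrDl A) (@mulrDr A)).
Qed.
Fact restrict_scale1 : left_id 1 restrict_scale.
Proof. exact: (@scale1r _ M). Qed.
Fact restrict_scaleDr : right_distributive restrict_scale +%R.
Proof. by move=> a x y; rewrite /restrict_scale scalerDr. Qed.
Fact restrict_scaleDl x : {morph restrict_scale^~ x : a b / a + b}.
Proof. by move=> a b; rewrite /restrict_scale /laurentC monalgUD scalerDl. Qed.
HB.instance Definition _ := GRing.Zmodule_isLmodule.Build A restrict_scalars
  restrict_scaleA restrict_scale1 restrict_scaleDr restrict_scaleDl.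

End RestrictScalars.

Section CoveringMaps.
Variable A : pzRingType.
Notation z := (laurentZ A).
Notation zn n := (<< 1 *g n >> : laurent A).

Lemma covering_map_in (P P' : seifert A) (g : seifert_mor P P') x :
  covering_map g (covering_in x) = covering_in (g x).
Proof.
rewrite [LHS]coker_map_projE; congr (covering_proj _ _).
exact: laurent_mapU.
Qed.

(** The covering endomorphism is inverse to [1 - z], hence is respected by every
    linear map of coverings. *)
Lemma covering_endo_comm (P P' : seifert A) (f : {linear covering P -> covering P'}) y :
  covering_endo P' (f y) = f (covering_endo P y).
Proof. by rewrite -{1}[y]covering_endoK linearZ covering_endoK'. Qed.

Lemma covering_map_act (P P' : seifert A) (f : {linear covering P -> covering P'}) p y :
  f (poly_act (covering_endo P) p y) = poly_act (covering_endo P') p (f y).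
Proof. exact: (poly_act_nat (covering_endo_comm f)). Qed.

Section Denominators.
Variable P : seifert A.
Notation e := (sf_endo P).
Notation be := (covering_endo P).

Lemma covering_act_zpos m (y : covering P) :
  poly_act be ('X ^+ m) (zn m%:Z *: y) = poly_act be (('X - 1) ^+ m) y.
Proof.
elim: m y => [|m IHm] y; first by rewrite !poly_act1 scale1r.
rewrite exprSr -poly_actA (_ : zn m.+1%:Z = z * zn m%:Z); last first.
  rewrite -[RHS]/(conv *%R _ _) (convU (@mulrDl A) (@mulrDr A)) mulr1.
  by congr (<< _ *g _ >>); lia.
rewrite -scalerA poly_actX linearZ /= scalez_covering_endo.
rewrite (_ : be _ - _ = poly_act be ('X - 1) (zn m%:Z *: y)); last first.
  by rewrite poly_actBl poly_actX poly_act1.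
by rewrite poly_actC IHm poly_actA exprS.
Qed.

Lemma covering_act_zneg m (y : covering P) :
  poly_act be ((1 - 'X) ^+ m) (zn (- m%:Z) *: y) = poly_act be ((- 'X) ^+ m) y.
Proof.
elim: m y => [|m IHm] y; first by rewrite oppr0 !poly_act1 scale1r.
rewrite exprSr -poly_actA (_ : zn (- m.+1%:Z) = zn (-1) * zn (- m%:Z)); last first.
  rewrite -[RHS]/(conv *%R _ _) (convU (@mulrDl A) (@mulrDr A)) mulr1.
  by congr (<< _ *g _ >>); lia.
rewrite -scalerA.
rewrite (_ : poly_act be (1 - 'X) _ = poly_act be (- 'X) (zn (- m%:Z) *: y)); last first.
  rewrite poly_actBl poly_act1 poly_actX poly_actN poly_actX.
  set w := zn (- m%:Z) *: y; apply/eqP; rewrite -opprB eqr_opp; apply/eqP.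
  by rewrite -scalez_covering_endo linearZ /= scalerA laurentZ_unit' scale1r.
by rewrite poly_actC IHm poly_actA exprS.
Qed.

(** When [|n| <= K], the polynomial by which [(e (1 - e))^K z^n] acts on the
    covering; for larger [|n|] the truncated subtraction gives a junk value. *)
Definition clear_poly (K : nat) (n : int) : {poly int} :=
  match n with
  | Posz m => 'X ^+ (K - m) * (1 - 'X) ^+ K * ('X - 1) ^+ m
  | Negz m => (1 - 'X) ^+ (K - m.+1) * 'X ^+ K * (- 'X) ^+ m.+1
  end.

Lemma clear_polyE K n x : (`|n| <= K)%N ->
  covering_in (poly_act e (clear_poly K n) x)
  = poly_act be (E1E ^+ K) (zn n *: covering_in x).
Proof.
rewrite covering_in_act; case: n => m /= mK.
  rewrite -poly_actA -covering_act_zpos poly_actA; congr (poly_act _ _ _).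
  by rewrite mulrAC -exprD subnK // exprMn.
rewrite -poly_actA NegzE -covering_act_zneg poly_actA; congr (poly_act _ _ _).
by rewrite mulrAC -exprD subnK // -exprMn mulrC.
Qed.

Fact mcoeff_laurentC_scale (a : A) (u : laurent_mod P) n :
  (laurentC a *: u)@_n = a *: u@_n.
Proof.
elim/malg_ind_add: u => [x i|u v eu ev]; last first.
  by rewrite scalerDr !mcoeffD eu ev scalerDr.
by rewrite laurent_scaleU add0r !mcoeffU scalerMnr.
Qed.

(** Clearing denominators: on elements supported in [[-K, K]], multiplication
    by [(e (1 - e))^K] lifts to a linear map into [P]. *)
Lemma clear_denominators (K : nat) :
  exists s : {linear restrict_scalars (laurent_mod P) -> P},
  forall u : laurent_mod P, (forall n : int, (K < `|n|)%N -> u@_n = 0) ->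
  covering_in (s u) = poly_act be (E1E ^+ K) (covering_proj P u).
Proof.
pose d (i : 'I_(K + K).+1) : int := i%:Z - K%:Z.
pose s (u : restrict_scalars (laurent_mod P)) : P :=
  \sum_i poly_act e (clear_poly K (d i)) (u : laurent_mod P)@_(d i).
have s_lin : linear s.
  move=> a u v; rewrite /s scaler_sumr -big_split; apply: eq_bigr => i _ /=.
  by rewrite mcoeffD mcoeff_laurentC_scale linearP.
pose S := GRing.isLinear.Build _ _ _ _ s s_lin.
exists (HB.pack s S : {linear restrict_scalars (laurent_mod P) -> P}) => u uK /=.
have uE : u = \sum_i << u@_(d i) *g d i >>.
  apply/malgP => n; rewrite raddf_sum /=.
  have [nK|Kn] := leqP `|n| K; last first.
    rewrite uK // big1 // => i _; rewrite mcoeffU.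
    by case: eqP => // din; have := ltn_ord i; rewrite -din /d in Kn *; lia.
  (* The coefficient of [z^n] sits at the shifted index [n + K]. *)
  have nK' : (`|(n + K%:Z)%R| < (K + K).+1)%N by lia.
  rewrite (bigD1 (Ordinal nK')) //= big1 => [|i ni].
    by rewrite /d /= (_ : _ - K%:Z = n) ?mcoeffUU ?addr0 //; lia.
  rewrite mcoeffU; case: eqP => // din; case/eqP: ni; apply: val_inj => /=.
  by rewrite -din /d; lia.
rewrite [in RHS]uE /s !raddf_sum; apply: eq_bigr => i _ /=.
rewrite clear_polyE ?covering_projU //.
by have := ltn_ord i; rewrite /d; lia.
Qed.

End Denominators.

(** Linear maps from a finitely generated module that agree in the localization
    agree after multiplication by a single power. *)
Lemma covering_in_eq_fg (Q : fgProj A) (P : seifert A) (t t' : {linear Q -> P}) :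
  (forall x, covering_in (t x) = covering_in (t' x)) ->
  exists k, forall x,
    poly_act (sf_endo P) (E1E ^+ k) (t x) = poly_act (sf_endo P) (E1E ^+ k) (t' x).
Proof.
move=> tt'; have [n [s sP]] := fgp_fg Q.
have [i|k kP] := choice (fun i => @covering_in_ker _ P (t (s i) - t' (s i)) _).
  by rewrite covering_in_zmod tt' subrr.
exists (\sum_i k i)%N => x; have [a ->] := sP x.
rewrite !linear_sum; apply: eq_bigr => i _; rewrite !linearZ /=; congr (_ *: _).
apply/eqP; rewrite -subr_eq0 -linearB /=.
by rewrite (bigD1 i) //= addnC exprD -poly_actA kP linear0.
Qed.

Section Iso.
Variables (P1 P0 : seifert A) (g : seifert_mor P1 P0).
Notation e1 := (sf_endo P1).
Notation e0 := (sf_endo P0).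

Lemma covering_iso_of_nilpotent (h : seifert_mor P0 P1) k :
  (forall x, g (h x) = poly_act e0 (E1E ^+ k) x) ->
  (forall x, h (g x) = poly_act e1 (E1E ^+ k) x) ->
  is_iso (covering_map g).
Proof.
move=> gh hg.
have Bgh : covering_map g \o covering_map h =1 poly_act (covering_endo P0) (E1E ^+ k).
  apply: covering_ext => x /=.
  by rewrite !covering_map_in gh covering_in_act.
have Bhg : covering_map h \o covering_map g =1 poly_act (covering_endo P1) (E1E ^+ k).
  apply: covering_ext => x /=.
  by rewrite !covering_map_in hg covering_in_act.
have [i1 i1K _] := covering_act_bij P1 k; have [i0 _ i0K] := covering_act_bij P0 k.
apply: bij_is_iso => [x y gxy|y].
  by rewrite -[x]i1K -[y]i1K -!Bhg /= gxy.
by exists (covering_map h (i0 y)); rewrite -[RHS]i0K -Bgh.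
Qed.

(** The inverse of the covering of [g], restricted to [P0], lifts to [P1] after
    multiplication by a power of [e (1 - e)]. *)
Lemma nilpotent_of_covering_iso : is_iso (covering_map g) ->
  exists (h : seifert_mor P0 P1) (k : nat),
    (forall x, g (h x) = poly_act e0 (E1E ^+ k) x) /\
    (forall x, h (g x) = poly_act e1 (E1E ^+ k) x).
Proof.
move=> [f [gK fK]].
pose LP1 := restrict_scalars (laurent_mod P1).
pose BP1 := restrict_scalars (covering P1).
pose c : LP1 -> BP1 := covering_proj P1.
have c_lin : linear c by move=> a u v; rewrite /c linearP.
pose cL : {linear LP1 -> BP1} := HB.pack c (GRing.isLinear.Build _ _ _ _ c c_lin).
pose b (x : P0) : BP1 := f (covering_in x).
have b_lin : linear b.
  by move=> a x y; rewrite /b raddfD /= covering_inZ linearP.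
pose bL : {linear P0 -> BP1} := HB.pack b (GRing.isLinear.Build _ _ _ _ b b_lin).
have [f' f'E] := fgp_proj (p := cL) bL (@covering_proj_surj _ P1).
have [K KP] : exists K : nat, forall x (n : int), (K < `|n|)%N ->
    (f' x : laurent_mod P1)@_n = 0.
  have [m [s sP]] := fgp_fg P0.
  (* A sum is a convenient upper bound for all degrees in the supports of the
     images of the generators. *)
  exists (\sum_i \sum_(n <- msupp (f' (s i) : laurent_mod P1)) `|n|)%N => x n Kn.
  have [a ->] := sP x; rewrite linear_sum raddf_sum big1 // => i _ /=.
  rewrite linearZ [LHS]mcoeff_laurentC_scale mcoeff_outdom ?scaler0 //.
  apply: contraTN Kn => nsi; rewrite -leqNgt.
  by rewrite (bigD1 i) //= (big_fsetD1 n nsi) /= -addnA leq_addr.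
have [s sE] := clear_denominators P1 K.
pose h0 : {linear P0 -> P1} := s \o f'.
have h0E x : covering_in (h0 x)
    = poly_act (covering_endo P1) (E1E ^+ K) (f (covering_in x)).
  by rewrite /h0 /= sE; [congr (poly_act _ _ _); exact: f'E|move=> n; apply: KP].
(* In the localization [h0] commutes with [e]; [h1] does so exactly. *)
have [x|l1 l1P] := @covering_in_eq_fg P0 P1 (e1 \o h0) (h0 \o e0).
  rewrite -[LHS]/(covering_in (e1 (h0 x))) -covering_endo_in [RHS]h0E h0E.
  by rewrite -covering_endo_in -covering_endo_comm poly_act_comm.
have h1_comm x : e1 (poly_act e1 (E1E ^+ l1) (h0 x))
    = poly_act e1 (E1E ^+ l1) (h0 (e0 x)).
  by rewrite poly_act_comm; exact: l1P.
pose h1 : seifert_mor P0 P1 :=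
  @SeifertMor A P0 P1 (poly_act e1 (E1E ^+ l1) \o h0) h1_comm.
have h1E x : covering_in (h1 x)
    = poly_act (covering_endo P1) (E1E ^+ (l1 + K)) (f (covering_in x)).
  by rewrite [LHS]covering_in_act h0E poly_actA -exprD.
have [x|l2 l2P] :=
    @covering_in_eq_fg P0 P0 (g \o h1) (poly_act e0 (E1E ^+ (l1 + K))).
  rewrite -[LHS]/(covering_in (g (h1 x))) -covering_map_in h1E.
  by rewrite covering_map_act fK covering_in_act.
have [x|l3 l3P] :=
    @covering_in_eq_fg P1 P1 (h1 \o g) (poly_act e1 (E1E ^+ (l1 + K))).
  by rewrite [LHS]h1E -covering_map_in gK covering_in_act.
have h_comm x : e1 (poly_act e1 (E1E ^+ (l2 + l3)) (h1 x))
    = poly_act e1 (E1E ^+ (l2 + l3)) (h1 (e0 x)).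
  by rewrite poly_act_comm sm_comm.
exists (@SeifertMor A P0 P1 (poly_act e1 (E1E ^+ (l2 + l3)) \o h1) h_comm).
exists (l2 + l3 + (l1 + K))%N; split=> x.
  rewrite [LHS]seifert_mor_act [in RHS]exprD -poly_actA.
  by rewrite [(l2 + l3)%N]addnC (exprD _ l3) -!poly_actA [X in poly_act _ _ X]l2P.
rewrite -[LHS]/(poly_act e1 _ (h1 (g x))) [in RHS]exprD -poly_actA.
by rewrite (exprD _ l2 l3) -!poly_actA [X in poly_act _ _ X]l3P.
Qed.

End Iso.
End CoveringMaps.

(** * The equivalence of the three conditions *)

Theorem proposition2p4 (A : pzRingType) (P1 P0 : seifert A)
    (g : seifert_mor P1 P0) :
  let C := seifert_complex g in
  let e : chain_map C C := seifert_chain_endo g in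
  let cond_i : Prop := is_iso (covering_map g) in
  let cond_ii : Prop :=
    exists (h : seifert_mor P0 P1) (k : nat),
      [/\ forall x : P0, g (h x) = iter k (sf_e1e P0) x,
          forall x : P1, h (g x) = iter k (sf_e1e P1) x
        & chain_homotopy (C := C) (D := C) h
            (cm_exp (cm_e1e e) k) (cm_zero C C)] in
  let cond_iii : Prop :=
    exists (Cp Cm : complex1 A)
           (ep : chain_map Cp Cp) (em : chain_map Cm Cm)
           (ip : chain_map C Cp) (im : chain_map C Cm),
      chain_homotopy_nilpotent (cm_sub (cm_id Cp) ep) /\
      chain_homotopy_nilpotent em /\
      chain_equivalence (cm_pair ip im) /\
      cm_eq (cm_comp ep ip) (cm_comp ip e) /\
      cm_eq (cm_comp em im) (cm_comp im e) in
  (cond_i <-> cond_ii) /\ (cond_ii <-> cond_iii).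
Proof.
move=> C e cond_i cond_ii cond_iii.
pose cond_ii' := exists (h : seifert_mor P0 P1) (k : nat),
  (forall x, g (h x) = poly_act (sf_endo P0) (E1E ^+ k) x) /\
  (forall x, h (g x) = poly_act (sf_endo P1) (E1E ^+ k) x).
have iiP : cond_ii <-> cond_ii'.
  split=> [[h [k [gh hg _]]]|[h [k [gh hg]]]]; exists h, k.
    by split=> x; rewrite -iter_sf_e1e.
  split=> [x|x|]; rewrite ?iter_sf_e1e //.
  by apply/chain_homotopy_exp0; split=> x; rewrite [LHS](gh, hg) -iter_sf_e1e.
split; rewrite iiP; split.
- exact: nilpotent_of_covering_iso.
- by move=> [h [k [gh hg]]]; apply: covering_iso_of_nilpotent gh hg.
- by move=> [h [k [gh hg]]]; apply: splitting_of_nilpotent gh hg.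
move=> [Cp [Cm [ep [em [ip [im [nil_p [nil_m [equiv [pe me]]]]]]]]]].
exact: nilpotent_of_splitting nil_p nil_m equiv pe me.
Qed.
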